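(* Let $p,m\ge 2$ be integers and let $P=\{321,\; p(p+1)12\cdots(p-1),\; (m+1)12\cdots m\}$. Then $P$ is a regular set of forbidden patterns, and its succession function is $$\chi_P(i,k)=\begin{cases} k+1 & \text{if } i=1 \text{ and } k<m,\\ m & \text{if } i=1 \text{ and } k=m,\\ i & \text{if } 1<i<p,\\ p-1 & \text{otherwise.}\end{cases}$$
   Context: A permutation contains a pattern $\sigma$ if some subsequence is order-isomorphic to $\sigma$; $S_n(P)$ is the set of permutations of $\{1,\dots,n\}$ avoiding all patterns in $P$ ($S_0(P)=\{\epsilon\}$), and $S(P)=\bigcup_n S_n(P)$. $P$ is right-justified if, for every $\alpha\in S(P)$, moving the largest entry one position to the right (when possible) gives a permutation in $S(P)$. A site of a permutation of length $n$ is one of the $n+1$ gaps (before the first entry, between consecutive entries, after the last entry); sites are numbered from right to left, so the site after the last entry is site $1$; the empty permutation has one site. For $\alpha\in S_n$, $\alpha^{\downarrow i}$ is obtained by inserting $n+1$ into site $i$ of $\alpha$. For $\alpha\in S_n(P)$, site $i$ is active if $\alpha^{\downarrow i}\in S_{n+1}(P)$. A right-justified set $P$ is regular if for every $\alpha\in S(P)$: site $1$ of $\alpha$ is active, and whenever $\alpha$ has $k$ active sites, for each $1\le i\le k$ the number of active sites of $\alpha^{\downarrow i}$ depends only on $i$ and $k$ (not on $\alpha$); this number is denoted $\chi_P(i,k)$, and $\chi_P$ is the succession function. (For right-justified $P$, the active sites of $\alpha$ are exactly $1,\dots,k$ for some $k$.) *)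

(* Defs.v *)
From mathcomp Require Import all_boot.

Set Implicit Arguments.
Unset Strict Implicit.
Unset Printing Implicit Defensive.

(** Plain MathComp. A permutation of {1, ..., n} is the [seq nat] of its
    one-line notation; a pattern is a permutation in the same encoding, and a
    finite set of patterns is a [seq (seq nat)]. *)

Definition order_iso (s t : seq nat) : bool :=
  (size s == size t) &&
  [forall i : 'I_(size s), forall j : 'I_(size s),
     (nth 0 s i < nth 0 s j) == (nth 0 t i < nth 0 t j)].

Definition contains (s sigma : seq nat) : bool :=
  [exists b : (size s).-tuple bool, order_iso (mask b s) sigma].

Lemma containsP s sigma :
  reflect (exists2 t, subseq t s & order_iso t sigma) (contains s sigma).
Proof.
apply: (iffP existsP) => [[b iso_b] | [t /subseqP[b sz_b ->] iso_b]].
  by exists (mask b s); first exact: mask_subseq.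
by exists (tcast sz_b (in_tuple b)); rewrite val_tcast.
Qed.

(** [avoiders P n] is S_n(P). *)
Definition avoiders (P : seq (seq nat)) (n : nat) : pred (seq nat) :=
  [pred s | perm_eq s (iota 1 n) & all (fun sigma => ~~ contains s sigma) P].

(** S(P), the union of the S_n(P): a member of S_n(P) has size n. *)
Definition avoiding (P : seq (seq nat)) : pred (seq nat) :=
  [pred s | s \in avoiders P (size s)].

Lemma avoidingP P s : reflect (exists n, s \in avoiders P n) (s \in avoiding P).
Proof.
apply: (iffP idP) => [sP | [n sPn]]; first by exists (size s).
suff sz_s : size s = n by rewrite inE sz_s.
by case/andP: sPn => /perm_size; rewrite size_iota.
Qed.

(** In a permutation [alpha], the largest entry is [size alpha]. *)
Definition right_justified (P : seq (seq nat)) : Prop :=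
  forall (u v : seq nat) (a b : nat),
    let alpha := u ++ [:: a, b & v] in
    alpha \in avoiding P -> a = size alpha ->
    u ++ [:: b, a & v] \in avoiding P.

(** Insertion of n+1 into site [i], for 1 <= i <= n+1 with n = [size alpha].
    Sites are numbered from right to left starting at 1, so site [i] has
    [i - 1] entries to its right and [n + 1 - i] to its left. *)
Definition insert_max (alpha : seq nat) (i : nat) : seq nat :=
  take (size alpha + 1 - i) alpha
    ++ (size alpha).+1 :: drop (size alpha + 1 - i) alpha.

Definition active (P : seq (seq nat)) (alpha : seq nat) (i : nat) : bool :=
  insert_max alpha i \in avoiders P (size alpha).+1.

Definition num_active (P : seq (seq nat)) (alpha : seq nat) : nat :=
  count (active P alpha) (iota 1 (size alpha).+1).

Definition regular (P : seq (seq nat)) : Prop :=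
  [/\ right_justified P,
      forall alpha, alpha \in avoiding P -> active P alpha 1
    & forall alpha beta,
        alpha \in avoiding P -> beta \in avoiding P ->
        num_active P alpha = num_active P beta ->
        forall i, 1 <= i <= num_active P alpha ->
        num_active P (insert_max alpha i) = num_active P (insert_max beta i)].

(** [chi] is the succession function of the regular set [P]; chi_P(i,k) is only
    determined for 1 <= i <= k with k the number of active sites of some member
    of S(P). *)
Definition succession_function (P : seq (seq nat)) (chi : nat -> nat -> nat) :
    Prop :=
  forall alpha, alpha \in avoiding P ->
  forall i, 1 <= i <= num_active P alpha ->
    num_active P (insert_max alpha i) = chi i (num_active P alpha).

(* Main.v *)
(** A new largest entry can only play the role of the largest entry of a
    pattern.  So if [u ++ v] avoids the patterns, then inserting a new maximum
    between [u] and [v] preserves this iff [v] is increasing ([321]), has fewer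
    than [m] entries ([(m+1)12...m]), and no entry of [u] exceeds [p - 1]
    entries of [v] ([p(p+1)12...(p-1)]).  This condition survives moving the
    first entry of [v] to [u], so the active sites are [1, ..., k].  After an
    insertion at site [1], the site [j + 1] is active iff [j] was and
    [j + 1 <= m]; after an insertion at a site [i > 1], every site [j > i]
    creates [321], and a site [j <= i] is active iff [j < p], because the
    previous maximum exceeds the [j - 1] entries right of the site. *)
Require Import Defs.
From mathcomp Require Import all_boot.
From mathcomp Require Import zify.

(** * Order isomorphism with patterns of special shape *)

Lemma order_isoP s t :
  reflect (size s = size t /\
           forall i j, i < size s -> j < size s ->
             (nth 0 s i < nth 0 s j) = (nth 0 t i < nth 0 t j))
          (order_iso s t).
Proof.
apply: (iffP andP) => [[/eqP sz_st /forallP iso_st] | [sz_st iso_st]].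
  split=> // i j lt_i lt_j.
  by have /forallP/(_ (Ordinal lt_j))/eqP := iso_st (Ordinal lt_i).
split; first exact/eqP.
by apply/forallP => i; apply/forallP => j; apply/eqP/iso_st.
Qed.

(** A dominating head settles every comparison that involves it, so only the tails remain to be
    compared. *)
Lemma order_iso_cons_max x s y t :
  all (gtn y) t -> order_iso (x :: s) (y :: t) = all (gtn x) s && order_iso s t.
Proof.
move=> /allP max_y; apply/order_isoP/andP => /= [[[sz_st] iso_st] | [/allP max_x]].
  split; last by apply/order_isoP; split=> // i j; apply: (iso_st i.+1 j.+1).
  apply/(all_nthP 0) => i lt_i; rewrite /= (iso_st i.+1 0) //=.
  by apply/max_y/mem_nth; rewrite -sz_st.
case/order_isoP=> sz_st iso_st; split; first by rewrite sz_st.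
have max_nth i : i < size s -> nth 0 s i < x /\ nth 0 t i < y.
  by move=> lt_i; split; [apply/max_x/mem_nth | apply/max_y/mem_nth; rewrite -sz_st].
case=> [|i] [|j] //=; rewrite ?ltnS ?ltnn //; last exact: iso_st.
  by move=> _ /max_nth[]; lia.
by move=> /max_nth[-> ->].
Qed.

Lemma order_iso_iota s m n :
  order_iso s (iota m n) = (size s == n) && sorted ltn s.
Proof.
apply/order_isoP/andP; rewrite size_iota => -[sz_s].
  move=> iso_s; split; first exact/eqP.
  apply/(sortedP 0) => i lt_i; rewrite /= iso_s ?(ltnW lt_i) //.
  by rewrite !nth_iota -?sz_s ?(ltnW lt_i) // ltn_add2l.
move=> sorted_s; split=> [|i j lt_i lt_j]; first exact/eqP.
have nth_lt := sorted_ltn_nth ltn_trans 0 sorted_s.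
rewrite !nth_iota -?(eqP sz_s) // ltn_add2l.
case: (ltngtP i j) => [|lt_ji|->]; last by rewrite ltnn.
  exact: nth_lt.
by have := nth_lt _ _ lt_j lt_i lt_ji; lia.
Qed.

(** * Pattern containment after inserting a maximum *)

Lemma contains_subseq s s' sigma :
  subseq s s' -> contains s sigma -> contains s' sigma.
Proof.
move=> sub_s /containsP[t sub_t iso_t]; apply/containsP; exists t => //.
exact: subseq_trans sub_t sub_s.
Qed.

Lemma subseq_remove (u v : seq nat) x : subseq (u ++ v) (u ++ x :: v).
Proof. exact: cat_subseq (subseq_refl _) (subseq_cons _ _). Qed.

Lemma subseq_insert (t u v : seq nat) x :
  subseq t (u ++ x :: v) ->
  subseq t (u ++ v) \/
  exists t1 t2, [/\ t = t1 ++ x :: t2, subseq t1 u & subseq t2 v].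
Proof.
elim: u t => [|y u IHu] [|z t] /=; try by left; rewrite ?sub0seq.
  case: (z =P x) => [-> sub_t|_ ?]; last by left.
  by right; exists [::], t.
case: (z =P y) => [->|_] /IHu[?|[t1 [t2 [def_t sub1 sub2]]]]; try by left.
  by right; exists (y :: t1), t2; rewrite /= eqxx def_t.
right; exists t1, t2; split=> //.
exact: subseq_trans sub1 (subseq_cons _ _).
Qed.

(* The inserted entry, being the largest, can only play the role of [y]. *)
Lemma contains_insert_head u v N y sigma :
  all (gtn N) (u ++ v) -> all (gtn y) sigma ->
  contains (u ++ N :: v) (y :: sigma) =
    contains (u ++ v) (y :: sigma) || contains v sigma.
Proof.
rewrite all_cat => /andP[/allP max_u /allP max_v] max_y; apply/idP/orP; last first.
  case=> [|/containsP[t sub_t iso_t]].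
    exact/contains_subseq/subseq_remove.
  apply/containsP; exists (N :: t).
    by apply: subseq_trans (suffix_subseq u _); rewrite /= eqxx.
  rewrite order_iso_cons_max // iso_t andbT.
  by apply/allP => z /(mem_subseq sub_t)/max_v.
case/containsP=> t /subseq_insert[sub_t | [[|a t1] [t2 [-> sub1 sub2]]]] iso_t.
- by left; apply/containsP; exists t.
- right; apply/containsP; exists t2 => //.
  by move: iso_t; rewrite order_iso_cons_max // => /andP[].
(* Otherwise the match starts at some [a] in [u], which would have to exceed [N]. *)
have /max_u/= lt_aN: a \in u by apply: (mem_subseq sub1); rewrite mem_head.
move: iso_t; rewrite order_iso_cons_max // all_cat /=.
by case/andP=> /and3P[_]; lia.
Qed.

Lemma order_iso_cons_second a b s x y t :
  x < y -> all (gtn x) t ->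
  order_iso [:: a, b & s] [:: x, y & t] =
    [&& a < b, all (gtn a) s & order_iso s t].
Proof.
move=> lt_xy /allP max_x; apply/order_isoP/and3P => /= [[[sz_st] iso_st] | ].
  split; first by rewrite (iso_st 0 1).
    apply/(all_nthP 0) => i lt_i; rewrite /= (iso_st i.+2 0) //=.
    by apply/max_x/mem_nth; rewrite -sz_st.
  by apply/order_isoP; split=> // i j; apply: (iso_st i.+2 j.+2).
case=> lt_ab /allP max_a /order_isoP[sz_st iso_st].
split; first by rewrite sz_st.
have max_nth i : i < size s -> nth 0 s i < a /\ nth 0 t i < x.
  by move=> lt_i; split; [apply/max_a/mem_nth | apply/max_x/mem_nth; rewrite -sz_st].
case=> [|[|i]] [|[|j]] //=; rewrite ?ltnS ?ltnn //; try (exact: iso_st);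
  by [lia | move=> /max_nth[]; lia | move=> _ /max_nth[]; lia].
Qed.

(** [N] can only play [y]. The role of [x] then falls to some [a] in [u], and [sigma] must be
    matched inside [v] below [a], hence the filter. *)
Lemma contains_insert_second u v N x y sigma :
  all (gtn N) (u ++ v) -> x < y -> all (gtn x) sigma ->
  contains (u ++ N :: v) [:: x, y & sigma] =
    contains (u ++ v) [:: x, y & sigma] ||
    has (fun a => contains [seq z <- v | z < a] sigma) u.
Proof.
rewrite all_cat => /andP[/allP max_u /allP max_v] lt_xy max_x.
apply/idP/orP; last first.
  case=> [|/hasP[a u_a /containsP[t]]]; first exact/contains_subseq/subseq_remove.
  rewrite subseq_filter => /andP[max_a sub_t iso_t].
  apply/containsP; exists [:: a, N & t].
    rewrite -[_ :: _ :: _]/([:: a] ++ _); apply: cat_subseq; first by rewrite sub1seq.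
    by rewrite /= eqxx.
  by rewrite order_iso_cons_second // max_a iso_t !andbT; apply: max_u.
case/containsP=> t /subseq_insert[sub_t | [t1 [t2 [-> sub1 sub2]]]].
  by left; apply/containsP; exists t.
(* Entries of the match before [N]: with none, [N] plays [x] and nothing can exceed it; with two or
   more, [N] is in the tail and must be below some [a] in [u]. Exactly one is left. *)
case: t1 sub1 => [_|a [|b t1] sub1].
- case: t2 sub2 => [_|b t2 sub2]; first by case/order_isoP=> /=; lia.
  rewrite order_iso_cons_second // => /and3P[].
  by have /max_v/= := mem_subseq sub2 (mem_head b t2); lia.
- rewrite order_iso_cons_second // => /and3P[_ max_a iso_t].
  right; apply/hasP; exists a; first by rewrite -sub1seq.
  by apply/containsP; exists t2; rewrite // subseq_filter max_a.
rewrite /= order_iso_cons_second // all_cat => /and3P[_ /and3P[_ lt_Na _] _].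
by have /max_u/= := mem_subseq sub1 (mem_head a _); move: lt_Na => /=; lia.
Qed.

Lemma contains_iota m n v :
  sorted ltn v -> contains v (iota m n) = (n <= size v).
Proof.
move=> sorted_v; apply/containsP/idP => [[t sub_t] | le_n].
  by rewrite order_iso_iota => /andP[/eqP<- _]; apply: size_subseq.
exists (take n v); first exact: take_subseq.
by rewrite order_iso_iota size_takel // eqxx take_sorted.
Qed.

(** Distinctness turns a failure of strict increase into a strictly decreasing pair. *)
Lemma contains_descent v : uniq v -> contains v [:: 2; 1] = ~~ sorted ltn v.
Proof.
have iso21 b c : order_iso [:: b; c] [:: 2; 1] = (c < b).
  rewrite order_iso_cons_max // /= andbT (order_iso_iota [:: c] 1 1).
  by rewrite /= andbT.
move=> uniq_v; apply/idP/idP => [/containsP[t sub_t iso_t] | ].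
  apply/negP => /(subseq_sorted ltn_trans sub_t).
  have [sz_t _] := order_isoP _ _ iso_t.
  case: t sz_t iso_t {sub_t} => [|b [|c []]] // _; rewrite iso21 /=; lia.
apply: contraR => avoid21; move: uniq_v avoid21.
elim: v => // x v IHv /= /andP[x_notin uniq_v] avoid21.
rewrite (path_sortedE ltn_trans) IHv ?andbT //; last first.
  by apply: contra avoid21; apply/contains_subseq/subseq_cons.
apply/allP => z v_z; apply: contraR avoid21 => le_zx; apply/containsP.
exists [:: x; z]; first by rewrite /= eqxx sub1seq.
by rewrite iso21 ltn_neqAle leqNgt le_zx andbT; apply: contraNneq x_notin => <-.
Qed.

(** * Permutations as lists, and counting initial segments *)

Lemma max_iota1 n : all (gtn n.+1) (iota 1 n).
Proof. by apply/allP => z; rewrite mem_iota => /andP[]. Qed.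

Lemma perm_iota_gt s n : perm_eq s (iota 1 n) -> all (gtn n.+1) s.
Proof. by move/perm_all->; apply: max_iota1. Qed.

Lemma perm_iota_insert u v n :
  perm_eq (u ++ n.+1 :: v) (iota 1 n.+1) = perm_eq (u ++ v) (iota 1 n).
Proof.
rewrite (perm_catCA u [:: n.+1] v) -[X in iota 1 X]addn1 iotaD add1n.
by rewrite perm_sym perm_catC perm_cons perm_sym.
Qed.

Lemma count_iota_leq k n : count (fun i => i <= k) (iota 1 n) = minn k n.
Proof.
elim: n => [|n IHn]; first by rewrite minn0.
by rewrite -[X in iota 1 X]addn1 iotaD count_cat IHn /=; lia.
Qed.

Lemma count_down_closed (a : pred nat) n :
  (forall i, 0 < i < n -> a i.+1 -> a i) ->
  forall i, 0 < i <= n -> a i = (i <= count a (iota 1 n)).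
Proof.
elim: n => [|n IHn] a_pred i; first by lia.
have {}IHn := IHn (fun j lt_j => a_pred j ltac:(lia)).
rewrite -[X in iota 1 X]addn1 iotaD count_cat /= add1n addn0.
have le_count : count a (iota 1 n) <= n by rewrite -{2}(size_iota 1 n) count_size.
have [-> _ | ne_in i_bd] := eqVneq i n.+1.
  case a_n1: (a n.+1); last by lia.
  case: n IHn a_pred le_count a_n1 => // n IHn a_pred le_count a_n1.
  by have := IHn n.+1; rewrite a_pred //; lia.
rewrite IHn; last by lia.
case a_n1: (a n.+1); last by rewrite addn0.
(* If [a] holds at [n.+1], it holds at [n], and induction forces the count up to [n] to be full. *)
have: a n by apply: a_pred => //; lia.
by rewrite IHn; lia.
Qed.

Lemma drop_catl (u v : seq nat) j :
  j <= size u -> drop j (u ++ v) = drop j u ++ v.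
Proof.
move=> le_j; rewrite drop_cat ltn_neqAle le_j andbT.
by case: eqP => // ->; rewrite subnn drop0 drop_size.
Qed.

(** * The three patterns and the insertion criterion *)

Definition patterns p m : seq (seq nat) :=
  [:: [:: 3; 2; 1]; [:: p, p.+1 & iota 1 p.-1]; m.+1 :: iota 1 m].

Definition insertable p m (u v : seq nat) :=
  [&& sorted ltn v, size v < m & all (fun a => count (gtn a) v < p.-1) u].

Section Patterns.

Variables (p m : nat).
Hypothesis p_gt1 : 1 < p.
Hypothesis m_gt1 : 1 < m.

Let P := patterns p m.
Let ok := insertable p m.

Lemma avoiding_perm s : s \in avoiding P -> perm_eq s (iota 1 (size s)).
Proof. by case/andP. Qed.

(** Since [u ++ v] already avoids [P], each insertion lemma leaves only its alternative that uses
    the new maximum. *)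
Lemma avoiders_insert_max u v :
  u ++ v \in avoiding P ->
  (u ++ (size (u ++ v)).+1 :: v \in avoiders P (size (u ++ v)).+1) = ok u v.
Proof.
case/andP=> perm_uv /and4P[/negPf av1 /negPf av2 /negPf av3 _].
have uv_max := perm_iota_gt _ _ perm_uv.
have uniq_v : uniq v.
  by have := perm_uniq perm_uv; rewrite iota_uniq cat_uniq => /and3P[].
have max_p : all (gtn p) (iota 1 p.-1) by rewrite -{1}(prednK (ltnW p_gt1)) max_iota1.
rewrite inE perm_iota_insert perm_uv /=.
rewrite (contains_insert_second _ _ _ p) // (contains_insert_head _ _ _ 3) //.
rewrite (contains_insert_head _ _ _ m.+1) ?max_iota1 //.
rewrite av1 av2 av3 /= contains_descent // negbK andbT /ok /insertable.
case sorted_v: (sorted ltn v) => //=.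
rewrite contains_iota // -ltnNge andbC; congr (_ && _).
rewrite -all_predC; apply: eq_all => a /=.
(* The entries of [v] below [a] are increasing, so containing [12...(p-1)] just means that there are
   at least [p - 1] of them. *)
rewrite contains_iota ?size_filter ?ltnNge //.
exact: sorted_filter ltn_trans _ _ sorted_v.
Qed.

Lemma size_insert (u v : seq nat) x : size (u ++ x :: v) = (size (u ++ v)).+1.
Proof. by rewrite !size_cat addnS. Qed.

Lemma avoiding_insert_max u v :
  u ++ v \in avoiding P ->
  (u ++ (size (u ++ v)).+1 :: v \in avoiding P) = ok u v.
Proof. by move=> av; rewrite -avoiders_insert_max // unfold_in /= size_insert. Qed.

Lemma avoiding_remove_max u v :
  u ++ (size (u ++ v)).+1 :: v \in avoiding P -> u ++ v \in avoiding P.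
Proof.
rewrite !unfold_in /= size_insert perm_iota_insert => /andP[-> /=].
by rewrite !andbT => /and3P[av1 av2 av3]; apply/and3P; split;
   [apply: contra av1 | apply: contra av2 | apply: contra av3];
   apply/contains_subseq/subseq_remove.
Qed.

(** As [b] heads an increasing list, it exceeds no entry of [v]: its count is 0, below [p.-1]
    because [p > 1]. Both right-justification and the interval shape of the active sites come from
    this. *)
Lemma insertable_shift u b v : ok u (b :: v) -> ok (rcons u b) v.
Proof.
case/and3P=> /= sorted_bv lt_bv /allP count_u; apply/and3P; split.
- exact: path_sorted sorted_bv.
- exact: ltnW.
rewrite all_rcons; apply/andP; split.
  rewrite (eq_in_count (a2 := pred0)) ?count_pred0 => [|z v_z /=]; first by lia.
  move: sorted_bv; rewrite (path_sortedE ltn_trans).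
  by case/andP=> /allP/(_ z v_z) /=; lia.
by apply/allP => a /count_u; apply: leq_ltn_trans; rewrite leq_addl.
Qed.

(** A final maximum keeps [v] increasing and adds nothing to the counts of entries of [u], so only
    the length bound tightens. *)
Lemma insertable_rcons u v N :
  all (gtn N) (u ++ v) -> ok u (rcons v N) = ok u v && ((size v).+1 < m).
Proof.
rewrite all_cat => /andP[/allP max_u max_v]; rewrite /ok /insertable size_rcons.
rewrite !(sorted_pairwise ltn_trans) pairwise_rcons [all _ v]max_v /=.
have -> : all (fun a => count (gtn a) (rcons v N) < p.-1) u =
          all (fun a => count (gtn a) v < p.-1) u.
  apply: eq_in_all => a /max_u /= lt_aN.
  by rewrite -cats1 count_cat /= (leq_gtF (ltnW lt_aN)) !addn0.
by case: pairwise; case: all; lia.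
Qed.

Lemma insertable_descent u v1 v2 N :
  v2 != [::] -> all (gtn N) v2 -> ok u (v1 ++ N :: v2) = false.
Proof.
case: v2 => // x v2 _ /= /andP[lt_xN _]; apply/negP => /and3P[sorted_v _ _].
have := subseq_sorted ltn_trans (suffix_subseq v1 _) sorted_v.
by move=> /= /andP[]; lia.
Qed.

(** [N] exceeds all of [v2], so its count is [size v2], the largest any entry can have; order and
    length conditions pass to a suffix. *)
Lemma insertable_suffix u v1 v2 N :
  ok u (v1 ++ v2) -> all (gtn N) v2 -> ok (u ++ N :: v1) v2 = (size v2 < p.-1).
Proof.
case/and3P=> sorted_v lt_v _ max_v2.
have sorted_v2 := subseq_sorted ltn_trans (suffix_subseq v1 v2) sorted_v.
have lt_v2 : size v2 < m by apply: leq_ltn_trans lt_v; rewrite size_cat leq_addl.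
rewrite /ok /insertable sorted_v2 lt_v2 /=; apply/idP/idP => [|lt_p].
  by rewrite all_cat /= => /and3P[_]; rewrite (eqP (_ : count _ _ == size v2)) -?all_count.
by apply/allP => a _; apply: leq_ltn_trans lt_p; apply: count_size.
Qed.

Lemma right_justified_patterns : right_justified P.
Proof.
move=> u v a b alpha avP def_a.
(* This presents [alpha] as an insertion into [u ++ b :: v]; moving [a] right is insertion into the
   next site. *)
have {}def_a : a = (size (u ++ b :: v)).+1 by rewrite def_a /alpha size_insert.
rewrite {}/alpha {}def_a in avP *.
have av_ubv := avoiding_remove_max _ _ avP.
move: avP; rewrite avoiding_insert_max // => /insertable_shift.
by have := avoiding_insert_max (rcons u b) v; rewrite !cat_rcons => ->.
Qed.

(** * Active sites and their number after an insertion *)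

Lemma activeE alpha i :
  alpha \in avoiding P ->
  active P alpha i =
    ok (take (size alpha + 1 - i) alpha) (drop (size alpha + 1 - i) alpha).
Proof.
move=> av; set j := size alpha + 1 - i.
have := avoiders_insert_max (take j alpha) (drop j alpha).
by rewrite cat_take_drop => /(_ av).
Qed.

Lemma active1 alpha : alpha \in avoiding P -> active P alpha 1.
Proof.
move=> av; rewrite activeE // addnK take_size drop_size.
apply/and3P; split; rewrite //= ?(ltnW m_gt1) //.
by apply/allP => a _ /=; lia.
Qed.

Lemma active_pred alpha i :
  alpha \in avoiding P -> 0 < i -> i <= size alpha ->
  active P alpha i.+1 -> active P alpha i.
Proof.
move=> av i_gt0 le_i; rewrite !activeE // addn1 subSS.
have lt_j : size alpha - i < size alpha by lia.
rewrite subSn // (take_nth 0) // (drop_nth 0) //; exact: insertable_shift.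
Qed.

Lemma active_leq_size alpha i :
  alpha \in avoiding P -> 0 < i <= (size alpha).+1 -> active P alpha i -> i <= m.
Proof.
by move=> av i_bd; rewrite activeE // => /and3P[_]; rewrite size_drop; lia.
Qed.

Lemma active_leq alpha i :
  alpha \in avoiding P -> 0 < i <= (size alpha).+1 ->
  active P alpha i = (i <= num_active P alpha).
Proof.
move=> av; apply: count_down_closed => j /andP[j_gt0 lt_j].
exact: active_pred.
Qed.

Lemma num_active_leq alpha : num_active P alpha <= (size alpha).+1.
Proof. by rewrite -(size_iota 1 (size alpha).+1) count_size. Qed.

(** Site [k] is itself active, so the [k - 1] entries to its right number fewer than [m]. *)
Lemma num_active_leq_m alpha : alpha \in avoiding P -> num_active P alpha <= m.
Proof.
move=> av; have le_k := num_active_leq alpha.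
have [-> // | k_gt0] := posnP (num_active P alpha).
apply: (active_leq_size _ _ av); first by rewrite k_gt0.
by rewrite active_leq ?k_gt0.
Qed.

Lemma insert_max_avoiding alpha i :
  active P alpha i -> insert_max alpha i \in avoiding P.
Proof. by move=> act; apply/avoidingP; eexists; exact: act. Qed.

Lemma size_insert_max alpha i : size (insert_max alpha i) = (size alpha).+1.
Proof. by rewrite size_insert cat_take_drop. Qed.

(** The minimum merges two clauses: [k + 1] when [k < m], and [m] when [k = m]. *)
Lemma num_active_insert_last alpha :
  alpha \in avoiding P ->
  num_active P (insert_max alpha 1) = (minn (num_active P alpha) m.-1).+1.
Proof.
move=> av; have act1 := active1 _ av.
have av1 := insert_max_avoiding _ _ act1.
rewrite {1}/num_active size_insert_max.
(* Split off the new site 1, which is active; the new site [1 + i] is the old site [i] with the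
   maximum appended on its right. *)
rewrite -[(size alpha).+2]add1n iotaD count_cat (iotaDl 1 1) count_map.
rewrite [count _ (iota 1 1)]/= active1 // add1n; congr _.+1.
have le_k := num_active_leq alpha.
transitivity (count (fun i => i <= minn (num_active P alpha) m.-1)
                    (iota 1 (size alpha).+1)); last first.
  by rewrite count_iota_leq; lia.
apply: eq_in_count => i; rewrite mem_iota => i_bd /=.
rewrite leq_min -(active_leq _ _ av); last by lia.
rewrite !activeE // size_insert_max.
have -> : insert_max alpha 1 = rcons alpha (size alpha).+1.
  by rewrite /insert_max addnK take_size drop_size cats1.
have le_j : size alpha + 1 - i <= size alpha by lia.
rewrite (_ : (size alpha).+1 + 1 - (1 + i) = size alpha + 1 - i); last by lia.
set j := size alpha + 1 - i in le_j *.
have max_N : all (gtn (size alpha).+1) (take j alpha ++ drop j alpha).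
  by rewrite cat_take_drop; apply/perm_iota_gt/avoiding_perm.
rewrite -cats1 takel_cat // drop_catl // cats1 insertable_rcons //.
by congr (_ && _); rewrite size_drop /j; lia.
Qed.

Lemma num_active_insert_inner alpha i :
  alpha \in avoiding P -> 1 < i <= num_active P alpha ->
  num_active P (insert_max alpha i) = minn i p.-1.
Proof.
move=> av i_bd; have le_k := num_active_leq alpha.
have act : active P alpha i by rewrite active_leq //; lia.
have av' := insert_max_avoiding _ _ act.
have max_N := perm_iota_gt _ _ (avoiding_perm _ av).
set c := size alpha + 1 - i; set u := take c alpha; set v := drop c alpha.
have sz_u : size u = c by rewrite size_takel // /c; lia.
have sz_v : size v = i.-1 by rewrite size_drop /c; lia.
have ok_uv : ok u v by rewrite -activeE.
have max_v : all (gtn (size alpha).+1) v.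
  by apply/allP => z /mem_drop; apply: (allP max_N).
have def_ins : insert_max alpha i = u ++ (size alpha).+1 :: v by [].
(* The extra bound is harmless as [i <= (size alpha).+1]; it gives the form of [count_iota_leq]. *)
have -> : minn i p.-1 = minn (minn i p.-1) (size alpha).+2 by lia.
rewrite /num_active size_insert_max -count_iota_leq.
apply: eq_in_count => j; rewrite mem_iota => j_bd.
rewrite activeE // size_insert_max def_ins leq_min.
(* Sites [j > i] lie left of the new maximum, which is followed by a smaller entry because [i > 1]
   makes [v] nonempty. *)
have [le_ji | lt_ij] := leqP j i; last first.
  by rewrite drop_catl ?insertable_descent -?size_eq0 ?sz_u ?sz_v // /c; lia.
rewrite take_cat drop_cat sz_u ltnNge (_ : c <= _) /=; last by rewrite /c; lia.
(* The successor steps over the maximum; the site then cuts [v] at [i - j], leaving [j - 1] entries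
   on its right. *)
rewrite (_ : _ - c = (i - j).+1) /=; last by rewrite /c; lia.
rewrite -(cat_take_drop (i - j) v) in ok_uv max_v.
rewrite insertable_suffix //; last by move: max_v; rewrite all_cat => /andP[].
by rewrite size_drop sz_v; lia.
Qed.

End Patterns.

Theorem theorem2 (p m : nat) (hp : 2 <= p) (hm : 2 <= m) :
  let P := [:: [:: 3; 2; 1]; [:: p, p.+1 & iota 1 p.-1]; m.+1 :: iota 1 m] in
  regular P /\
  succession_function P
    (fun i k => if (i == 1) && (k < m) then k.+1
                else if (i == 1) && (k == m) then m
                else if 1 < i < p then i
                else p.-1).
Proof.
move=> P.
(* This value depends only on [i] and [k], so it yields regularity as well as the succession
   function. *)
have succ_fun : forall alpha, alpha \in avoiding P ->
    forall i, 1 <= i <= num_active P alpha ->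
    num_active P (insert_max alpha i) =
      if i == 1 then (minn (num_active P alpha) m.-1).+1 else minn i p.-1.
  move=> alpha av i i_bd; case: eqP => [->|ne_i1].
    exact: num_active_insert_last.
  have {ne_i1} i_gt1 : 1 < i <= num_active P alpha by lia.
  exact: num_active_insert_inner.
split; first split.
- exact: right_justified_patterns.
- exact: active1.
- by move=> alpha beta av_a av_b eq_k i i_bd; rewrite !succ_fun -?eq_k.
move=> alpha av i i_bd; rewrite succ_fun //.
(* For [i = 1], the bound [k <= m] rules out the final clause. *)
have := num_active_leq_m p m hp hm _ av; rewrite -/P.
have [_|ne_i1 _] /= := eqVneq i 1; last by case: ifP; lia.
by case: ltngtP => // lt_km _; lia.
Qed.
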